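(* Let $G$ be a finite $2$-transitive permutation group on a set $X$ of size $n$ with minimal nonabelian normal subgroup $K$. Assume that $K$ is $2$-transitive on $X$ and that $\psi_K$ is the unique irreducible character of $K$ affording the least eigenvalue $-\frac{d_K}{n-1}$ of $\Gamma_K$. Then for any maximum coclique $S$ of $\Gamma_G$, the vector $v_S-\frac1n\mathbf{1}$ lies in the $\psi_G$-module.
   Context: For a permutation group $H$ on $X$, a derangement is an element with no fixed point; $\mathrm{Der}_H$ is the set of derangements of $H$ and $d_H=|\mathrm{Der}_H|$. The derangement graph $\Gamma_H$ is the Cayley graph on $H$ with connection set $\mathrm{Der}_H$ (two elements $g,h$ adjacent iff $hg^{-1}$ is a derangement). A coclique is an independent set; maximum means of largest size. For an irreducible character $\phi$ of $H$, the eigenvalue of $\Gamma_H$ afforded by $\phi$ is $\lambda_\phi=\frac{1}{\phi(1)}\sum_{d\in \mathrm{Der}_H}\phi(d)$. For a $2$-transitive $H$, the permutation character equals $1_H+\psi_H$ with $\psi_H$ irreducible of degree $n-1$. Vectors in $\mathbb{C}[G]$ are indexed by $G$; $v_S$ is the characteristic vector of $S\subseteq G$ and $\mathbf{1}$ the all-ones vector. For an irreducible character $\phi$ of $G$, $E_\phi$ is the $|G|\times|G|$ matrix with $(g,h)$-entry $\frac{\phi(1)}{|G|}\phi(hg^{-1})$, and the $\phi$-module is the image of $E_\phi$. *)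

(* Defs.v *)
From HB Require Import structures.
From mathcomp Require Import all_boot all_order all_algebra all_fingroup.
From mathcomp Require Import all_solvable all_field all_character.

Set Implicit Arguments.
Unset Strict Implicit.
Unset Printing Implicit Defensive.

Import Order.TTheory GRing.Theory Num.Theory.
Local Open Scope ring_scope.

Section DerangementGraph.

Variable T : finType.
Implicit Types (H : {group {perm T}}) (S : {set {perm T}}).

Definition derangements H : {set {perm T}} :=
  [set g in H | [forall x, g x != x]].

(* The derangement graph of H has vertex set H; this relation is only meant to
   be used between elements of H. *)
Definition derangement_adj H : rel {perm T} :=
  [rel g h | (h * g^-1)%g \in derangements H].

Definition coclique H S : Prop :=
  S \subset H /\ {in S &, forall g h, ~~ derangement_adj H g h}.

Definition maximum_coclique H S : Prop :=
  coclique H S /\ forall S' : {set {perm T}}, coclique H S' -> (#|S'| <= #|S|)%N.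

(* Matrices and vectors indexed by H are indexed by 'I_#|H| through the
   enumeration enum_val of H. *)
Definition derangement_adj_mx H : 'M[algC]_#|H| :=
  \matrix_(i, j) (derangement_adj H (enum_val i) (enum_val j))%:R.

Definition afforded_eigenvalue H (phi : 'CF(H)) : algC :=
  (phi 1%g)^-1 * \sum_(d in derangements H) phi d.

Definition least_eigenvalue m (A : 'M[algC]_m) (a : algC) : Prop :=
  eigenvalue A a /\ forall b, eigenvalue A b -> a <= b.

Definition unique_irr_affording H (phi : 'CF(H)) (a : algC) : Prop :=
  [/\ phi \in irr H, afforded_eigenvalue phi = a &
      {in irr H, forall xi, afforded_eigenvalue xi = a -> xi = phi}].

Fact perm_char_subproof H :
  is_class_fun <<H>>%g [ffun g : {perm T} =>
    (#|[set x | g x == x]|%:R : algC) *+ (g \in H)].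
Proof.
rewrite genGid; apply: intro_class_fun => [g h _ Hh | g /negbTE-> //].
rewrite groupJr //; congr (_%:R *+ _).
rewrite -[RHS](card_imset _ (@perm_inj _ h)); apply: eq_card => x.
rewrite inE -[x in LHS](permKV h) permJ (inj_eq perm_inj).
by rewrite -[x in RHS](permKV h) (mem_imset _ _ perm_inj) inE.
Qed.
Definition perm_char H : 'CF(H) := Cfun 0 (perm_char_subproof H).

Definition psi_char H : 'CF(H) := perm_char H - 1.

Definition char_vec H S : 'cV[algC]_#|H| :=
  \col_i (enum_val i \in S)%:R.

Definition idempotent_mx H (phi : 'CF(H)) : 'M[algC]_#|H| :=
  \matrix_(i, j) (phi 1%g / #|H|%:R * phi (enum_val j * (enum_val i)^-1)%g).

(* E_phi acts on column vectors, whereas the mxalgebra image of a matrix is its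
   row space. *)
Definition in_char_module H (phi : 'CF(H)) (v : 'cV[algC]_#|H|) : Prop :=
  exists w : 'cV[algC]_#|H|, v = idempotent_mx phi *m w.

End DerangementGraph.

(* Main.v *)
Require Import Defs.
From mathcomp Require Import all_boot all_order all_algebra all_fingroup.
From mathcomp Require Import all_solvable all_field all_character.
From mathcomp Require Import ring.
Import Order.TTheory GRing.Theory Num.Theory.
Local Open Scope ring_scope.

(** Put f = v_S - 1/n. The ratio bound for K, applied to the translates to K of
    the pieces of S in the cosets of K, gives |S| <= |G|/n; point stabilisers
    attain this bound, so it is tight in every coset, and the equality case
    places each piece of f in the psi_K-module. Hence, on a coset C = Kx,
    f(g) = (n-1)/|K| * sum_a M_C(a, g a), where the T x T matrix
    M_C(a, b) = sum_(g in C, g a = b) f(g) has zero row sums.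

    It remains to see that M_C does not depend on C. The derangements D in the
    coset relating C to C' are invariant under conjugation by the 2-transitive
    group K, so their permutation matrices sum to |D|/(n-1) * (J - I). Since S
    has no edge between C and C', this forces <M_C, M_C'> = |K|^2/n^2 for all C
    and C' (including C = C'), provided D is nonempty; hence
    |M_C - M_C'|^2 = 0. Every coset of K does contain a derangement: its elements
    have one fixed point on average, and one of them has at least two. *)

(** * Central idempotents and the spectrum of the derangement graph *)

Section SpectralDecomposition.

Variables (T : finType) (H : {group {perm T}}).
Implicit Types (i j : Iirr H) (v w : 'cV[algC]_#|H|).

Local Notation E i := (idempotent_mx 'chi[H]_i).
Local Notation A := (derangement_adj_mx H).
Local Notation lambda i := (afforded_eigenvalue 'chi[H]_i).

Lemma sum_ord_group (F : {perm T} -> algC) :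
  \sum_(k < #|H|) F (enum_val k) = \sum_(g in H) F g.
Proof. by rewrite [RHS]big_enum_val. Qed.

Lemma cardG_neq0C : #|H|%:R != 0 :> algC.
Proof. by rewrite pnatr_eq0 -lt0n cardG_gt0. Qed.

(** Entrywise the sum is the regular character divided by [#|H|], the indicator of the identity. *)
Lemma sum_idempotent_mx : \sum_i E i = 1%:M.
Proof.
apply/matrixP=> k l; rewrite summxE !mxE.
transitivity (#|H|%:R^-1 * cfReg H (enum_val l * (enum_val k)^-1)%g).
  rewrite cfReg_sum sum_cfunE mulr_sumr; apply: eq_bigr => i _.
  by rewrite !mxE cfunE; ring.
rewrite cfRegE -eq_mulgV1 (inj_eq enum_val_inj) eq_sym.
by case: eqP => _; rewrite ?mulr0 ?mulVf ?cardG_neq0C.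
Qed.

Lemma mul_idempotent_mx i j : E i *m E j = (i == j)%:R *: E i.
Proof.
apply/matrixP=> k l; rewrite !mxE.
under eq_bigr do rewrite !mxE.
have Hl := enum_valP l.
rewrite (sum_ord_group (fun g => 'chi_i 1%g / #|H|%:R *
  'chi_i (g * (enum_val k)^-1)%g * ('chi_j 1%g / #|H|%:R *
  'chi_j (enum_val l * g^-1)%g))).
(* Replacing [g] by [g * enum_val l] turns the last factor into ['chi_j g^-1], as generalized
   orthogonality requires. *)
rewrite (reindex_inj (mulIg (enum_val l))) /=.
rewrite (eq_bigl (mem H)); last by move=> g; rewrite groupMr.
transitivity ('chi_i 1%g * 'chi_j 1%g / #|H|%:R * (#|H|%:R^-1 *
    \sum_(x in H) 'chi_i (x * (enum_val l * (enum_val k)^-1))%g * 'chi_j x^-1%g)).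
  rewrite !mulr_sumr; apply: eq_bigr => g _.
  by rewrite invMg mulKVg mulgA; ring.
rewrite generalized_orthogonality_relation.
have [<-|_] := eqVneq i j; last by rewrite !mul0r mulr0.
rewrite !mul1r; field.
by rewrite cardG_neq0C irr1_neq0.
Qed.

Lemma idempotent_mx_conj i k l : (E i k l)^* = E i l k.
Proof.
rewrite !mxE rmorphM /= -irr_inv invMg invgK rmorphM /= fmorphV /= rmorph_nat.
by rewrite conj_Creal // gtr0_real ?irr1_gt0.
Qed.

Lemma derangementsV g : (g^-1%g \in derangements H) = (g \in derangements H).
Proof.
rewrite !inE groupV; congr (_ && _).
apply/forallP/forallP => der x; apply: contra (der x) => /eqP.
  by move=> gx; rewrite -{1}gx permK.
by move=> gx; rewrite -{1}gx permKV.
Qed.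

Lemma derangementsJ g h :
  h \in H -> ((g ^ h)%g \in derangements H) = (g \in derangements H).
Proof.
move=> Hh; rewrite !inE groupJr //; congr (_ && _).
apply/forallP/forallP => der x.
  by have := der (h x); rewrite permJ (inj_eq perm_inj).
by rewrite -[x](permKV h) permJ (inj_eq perm_inj).
Qed.

Fact derangement_indicator_subproof :
  is_class_fun <<H>>%g [ffun g => (g \in derangements H)%:R : algC].
Proof.
rewrite genGid; apply: intro_class_fun => [g h _ Hh | g].
  by rewrite derangementsJ.
by rewrite inE => /negbTE->.
Qed.
Definition derangement_indicator : 'CF(H) := Cfun 0 derangement_indicator_subproof.

(** The entries of [A] are values of the class function [derangement_indicator], expanded here in
    irreducible characters. Derangements are closed under inversion, which absorbs the conjugation
    in the inner product. *)
Lemma derangement_adj_mx_sum : A = \sum_i lambda i *: E i.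
Proof.
apply/matrixP=> k l; rewrite summxE mxE.
rewrite /derangement_adj /=.
set y := (enum_val l * (enum_val k)^-1)%g.
transitivity (derangement_indicator y); first by rewrite cfunElock.
rewrite (cfun_sum_cfdot derangement_indicator) sum_cfunE.
apply: eq_bigr => i _; rewrite !mxE cfunE mulrA; congr (_ * _).
rewrite cfdotE /afforded_eigenvalue mulrA -mulrA.
transitivity (#|H|%:R^-1 * \sum_(d in derangements H) 'chi_i d); last first.
  by field; rewrite cardG_neq0C irr1_neq0.
congr (_ * _); rewrite (reindex_inj invg_inj) /=.
rewrite [RHS](eq_bigl (fun g => (g \in H) && (g \in derangements H))); last first.
  by move=> g; rewrite !inE; case: (g \in H).
rewrite big_mkcondr; apply: eq_big => [g|g _]; first by rewrite groupV.
by rewrite cfunElock -irr_inv invgK derangementsV; case: ifP; rewrite ?mul1r ?mul0r.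
Qed.

Lemma afforded_eigenvalueP i : eigenvalue A (lambda i).
Proof.
have EA : E i *m A = lambda i *: E i.
  rewrite derangement_adj_mx_sum mulmx_sumr (bigD1 i) //= big1 => [|j /negbTE ji].
    by rewrite -scalemxAr mul_idempotent_mx eqxx scale1r addr0.
  by rewrite -scalemxAr mul_idempotent_mx eq_sym ji scale0r scaler0.
(* Each diagonal entry of [E i] is ['chi_i(1)^2 / #|H|], so no row vanishes; the row of the identity
   serves as eigenvector. *)
pose k := enum_rank_in (group1 H) 1%g.
apply/eigenvalueP; exists (row k (E i)).
  by rewrite -row_mul EA; apply/rowP => l; rewrite !mxE.
apply/eqP => /rowP/(_ k); rewrite !mxE mulgV => /eqP.
by rewrite !mulf_eq0 invr_eq0 (negbTE cardG_neq0C) (negbTE (irr1_neq0 i)).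
Qed.

Lemma afforded_eigenvalue0 : lambda 0 = #|derangements H|%:R.
Proof.
rewrite /afforded_eigenvalue irr0 cfun11 invr1 mul1r -sum1_card natr_sum.
by apply: eq_bigr => d; rewrite inE => /andP[Hd _]; rewrite cfun1E Hd.
Qed.

Definition weight i v : algC := \sum_k `|(E i *m v) k 0| ^+ 2.

Lemma weight_ge0 i v : 0 <= weight i v.
Proof. by apply: sumr_ge0 => k _; rewrite exprn_ge0. Qed.

Lemma weight_eq0 i v : weight i v = 0 -> E i *m v = 0.
Proof.
move=> w0; apply/colP => k; rewrite [RHS]mxE; apply/eqP.
rewrite -normr_eq0 -sqrf_eq0; apply/eqP.
exact: (psumr_eq0P (fun l _ => exprn_ge0 2 (normr_ge0 ((E i *m v) l 0))) w0 isT).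
Qed.

(** [E i] is a Hermitian idempotent, so its form is the squared norm of the projection; for real [v]
    the transpose is the adjoint. *)
Lemma form_idempotent_mx i v :
  (forall k, v k 0 \is Num.real) -> v^T *m (E i *m v) = (weight i v)%:M.
Proof.
move=> vR; apply/rowP=> o; rewrite !ord1 [RHS]mxE mulr1n {o}.
have {1}-> : E i = E i *m E i by rewrite mul_idempotent_mx eqxx scale1r.
rewrite -[X in _ *m X]mulmxA [v^T *m _]mulmxA mxE; apply: eq_bigr => k _.
rewrite normCKC; congr (_ * _).
rewrite [LHS]mxE [in RHS]mxE rmorph_sum; apply: eq_bigr => l _.
by rewrite rmorphM /= idempotent_mx_conj mulrC [v^T _ _]mxE (CrealP (vR l)).
Qed.

Lemma sum_weight v :
  (forall k, v k 0 \is Num.real) -> v^T *m v = (\sum_i weight i v)%:M.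
Proof.
move=> vR; rewrite -[X in _ *m X]mul1mx -sum_idempotent_mx.
rewrite mulmx_suml mulmx_sumr raddf_sum.
by apply: eq_bigr => i _; rewrite form_idempotent_mx.
Qed.

Lemma form_derangement_adj_mx v :
  (forall k, v k 0 \is Num.real) ->
  v^T *m (A *m v) = (\sum_i lambda i * weight i v)%:M.
Proof.
move=> vR; rewrite derangement_adj_mx_sum mulmx_suml mulmx_sumr raddf_sum.
apply: eq_bigr => i _.
by rewrite -scalemxAl -scalemxAr form_idempotent_mx // scale_scalar_mx.
Qed.

Lemma char_vec_real (S : {set {perm T}}) k : char_vec H S k 0 \is Num.real.
Proof. by rewrite mxE realn. Qed.

Lemma sum_char_vec (S : {set {perm T}}) :
  S \subset H -> \sum_k char_vec H S k 0 = #|S|%:R.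
Proof.
move=> sSH; under eq_bigr do rewrite mxE.
rewrite (sum_ord_group (fun g => (g \in S)%:R)) -sum1_card natr_sum.
rewrite [RHS]big_mkcond [LHS]big_mkcond; apply: eq_bigr => g _.
by case: (boolP (g \in S)) => [/(subsetP sSH) ->|_] //; case: ifP.
Qed.

Lemma norm_char_vec (S : {set {perm T}}) :
  S \subset H -> (char_vec H S)^T *m char_vec H S = (#|S|%:R)%:M.
Proof.
move=> sSH; apply/rowP=> o; rewrite !ord1 [RHS]mxE mulr1n -(sum_char_vec _ sSH) mxE.
by apply: eq_bigr => k _; rewrite !mxE -natrM mulnb andbb.
Qed.

Lemma form_coclique (S : {set {perm T}}) :
  coclique H S -> (char_vec H S)^T *m (A *m char_vec H S) = 0.
Proof.
move=> [sSH cS]; apply/rowP=> o; rewrite !ord1 [RHS]mxE mxE big1 // => k _.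
rewrite !mxE big_distrr big1 //= => l _; rewrite !mxE -!natrM !mulnb.
case: (boolP (enum_val k \in S)) => //= Sk.
case: (boolP (enum_val l \in S)) => //= Sl.
  by have /= /negbTE-> := cS _ _ Sk Sl.
by rewrite andbF.
Qed.

Lemma idempotent_mx0_char_vec (S : {set {perm T}}) :
  S \subset H -> E 0 *m char_vec H S = (#|S|%:R / #|H|%:R) *: const_mx 1.
Proof.
move=> sSH; apply/colP=> k; rewrite !mxE mulr1 mulrC -(sum_char_vec _ sSH) mulr_sumr.
apply: eq_bigr => l _; rewrite !mxE irr0 cfun11 cfun1E.
by rewrite groupM ?groupV ?enum_valP // mul1r mulr1.
Qed.

Lemma weight0_char_vec (S : {set {perm T}}) :
  S \subset H -> weight 0 (char_vec H S) = #|S|%:R ^+ 2 / #|H|%:R.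
Proof.
move=> sSH; rewrite /weight idempotent_mx0_char_vec //.
under eq_bigr do rewrite !mxE mulr1 ger0_norm ?divr_ge0 ?ler0n //.
rewrite sumr_const card_ord -mulr_natr; field.
exact: cardG_neq0C.
Qed.

(** * The ratio bound for cocliques and its equality case *)

Section RatioBound.

Variables (n : nat) (S : {set {perm T}}).
Hypotheses (n_gt1 : (1 < n)%N) (cocliqueS : coclique H S).
Hypothesis der_gt0 : (0 < #|derangements H|)%N.

Let d : algC := #|derangements H|%:R.
Let tau : algC := - (d / (n%:R - 1)).

Hypothesis least_tau : least_eigenvalue A tau.

Let n1_gt0 : 0 < n%:R - 1 :> algC.
Proof. by rewrite subr_gt0 ltr1n. Qed.
Let d_gt0 : 0 < d. Proof. by rewrite ltr0n. Qed.

Let v := char_vec H S.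

Let gap_ge0 i : 0 <= (lambda i - tau) * weight i v.
Proof.
rewrite mulr_ge0 ?weight_ge0 // subr_ge0.
by have [_] := least_tau; apply; apply: afforded_eigenvalueP.
Qed.

(** On a coclique the form of [A] vanishes, so that of [A - tau] equals [- tau * #|S|]. Removing the
    explicit trivial term leaves nonnegative terms, and the sign of the last factor is the ratio
    bound. *)
Lemma sum_gap :
  \sum_(i | i != 0) (lambda i - tau) * weight i v =
  d * #|S|%:R / ((n%:R - 1) * #|H|%:R) * (#|H|%:R - n%:R * #|S|%:R).
Proof.
have [sSH _] := cocliqueS.
have scalarI (a b : algC) : a%:M = b%:M :> 'M_1 -> a = b.
  by move/matrixP/(_ 0 0); rewrite !mxE !mulr1n.
have wl : \sum_i lambda i * weight i v = 0.
  apply: scalarI; rewrite -form_derangement_adj_mx; last exact: char_vec_real.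
  by rewrite form_coclique // raddf0.
have w1 : \sum_i weight i v = #|S|%:R.
  apply: scalarI; rewrite -sum_weight; last exact: char_vec_real.
  exact: norm_char_vec.
have : \sum_i (lambda i - tau) * weight i v = - tau * #|S|%:R.
  under eq_bigr do rewrite mulrBl.
  rewrite sumrB wl -mulr_sumr w1 sub0r; exact: esym (mulNr _ _).
rewrite (bigD1 0) //= weight0_char_vec // afforded_eigenvalue0 -/d.
move/(canRL (addKr _)) ->; rewrite /tau; field.
by rewrite cardG_neq0C gt_eqF.
Qed.

Lemma ratio_bound : (n * #|S| <= #|H|)%N.
Proof.
have [->|S_gt0] := posnP #|S|; first by rewrite muln0.
have: 0 <= \sum_(i | i != 0) (lambda i - tau) * weight i v.
  exact: sumr_ge0.
rewrite sum_gap pmulr_rge0 ?subr_ge0 -?natrM ?ler_nat //.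
by rewrite divr_gt0 ?ltr0n ?muln_gt0 ?der_gt0 ?mulr_gt0 ?ltr0n ?cardG_gt0.
Qed.

(** Tightness makes the sum in [sum_gap] vanish, hence each term; only the trivial character and the
    one affording [tau] can have a nonzero component. *)
Lemma ratio_bound_eq (psi : 'CF(H)) :
  unique_irr_affording psi tau -> (n * #|S| = #|H|)%N ->
  idempotent_mx psi *m v = v - n%:R^-1 *: const_mx 1.
Proof.
move=> [/irrP[j ->] lambda_j uniq_j] tight.
have [sSH _] := cocliqueS.
have lambda0 : lambda 0 != tau.
  rewrite afforded_eigenvalue0 -/d gt_eqF // /tau.
  by apply: (@lt_trans _ _ 0) => //; rewrite oppr_lt0 divr_gt0.
have gap0 i : i != 0 -> (lambda i - tau) * weight i v = 0.
  have := psumr_eq0P (P := fun i : Iirr H => i != 0) (fun i _ => gap_ge0 i).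
  by rewrite sum_gap -natrM tight subrr mulr0; apply.
have j0 : j != 0 by apply: contra lambda0 => /eqP <-; apply/eqP.
rewrite -[v in RHS]mul1mx -sum_idempotent_mx mulmx_suml (bigD1 0) //=.
rewrite (bigD1 j) //= big1 => [|i /andP[i0 ij]].
  (* The trivial component of [v] is the constant [#|S| / #|H|], which tightness makes [1/n]. *)
  suff <- : #|S|%:R / #|H|%:R = n%:R^-1 :> algC.
    by rewrite idempotent_mx0_char_vec // addr0 addrAC subrr add0r.
  rewrite -tight natrM invfM mulrCA mulfV ?mulr1 // pnatr_eq0.
  by apply: contraTneq (cardG_gt0 H) => S0; rewrite -tight S0 muln0.
apply: weight_eq0; apply/eqP; move/eqP: (gap0 _ i0); rewrite mulf_eq0 subr_eq0.
case/orP => // /eqP/uniq_j; rewrite mem_irr => /(_ isT) /irr_inj ji.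
by rewrite ji eqxx in ij.
Qed.

End RatioBound.

End SpectralDecomposition.

(** * Point counts in cosets of a 2-transitive group *)

Section TwoTransitive.

Variables (T : finType) (K : {group {perm T}}).
Hypothesis trK : [transitive^2 K, on [set: T] | 'P].

Local Notation n := #|T|.

Lemma trans2_card_gt1 : (1 < n)%N.
Proof.
have /imsetP[t] := trK; rewrite inE => /andP[/card_uniqP t2 _] _.
by rewrite -{1}(size_tuple t) -t2 max_card.
Qed.

Lemma trans2P a b c d : a != b -> c != d ->
  exists2 k, k \in K & k a = c /\ k b = d.
Proof.
have dt x y : x != y -> [tuple x; y] \in 2.-dtuple([set: T]).
  by move=> xy; rewrite inE /= inE xy /=; apply/subsetP.
move=> /dt ab /dt cd; have [k Kk /(congr1 val) []] := atransP2 trK ab cd.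
by exists k.
Qed.

Lemma trans1P a b : exists2 k, k \in K & k a = b.
Proof.
have tr1 := ntransitive1 (isT : 0 < 2)%N trK.
by have [k Kk ->] := atransP2 tr1 (in_setT a) (in_setT b); exists k.
Qed.

Let n_gt0 : (0 < n)%N. Proof. exact: ltnW trans2_card_gt1. Qed.
Let n_neq0 : n%:R != 0 :> algC. Proof. by rewrite pnatr_eq0 -lt0n. Qed.
Let n1_neq0 : n%:R - 1 != 0 :> algC.
Proof. by rewrite subr_eq0 gt_eqF // ltr1n trans2_card_gt1. Qed.

Lemma sum_delta (F : T -> algC) a : \sum_b F b * (a == b)%:R = F a.
Proof.
rewrite (bigD1 a) //= eqxx mulr1 big1 ?addr0 // => b ba.
by rewrite eq_sym (negbTE ba) mulr0.
Qed.

(** Left multiplication by [K] preserves the coset and moves [a] anywhere, so the count is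
    independent of [a]; each [g] sends exactly one point to [b]. *)
Lemma coset_point_count z a b :
  \sum_(g in (K :* z)%g) (g a == b)%:R = #|K|%:R / n%:R :> algC.
Proof.
pose N a' : algC := \sum_(g in (K :* z)%g) (g a' == b)%:R.
have Nconst a' : N a' = N a.
  have [t Kt <-] := trans1P a a'.
  rewrite [RHS](reindex_inj (mulgI t)) /=; apply: eq_big => [g|g _].
    by rewrite !mem_rcoset -mulgA (groupMl _ Kt).
  by rewrite permM.
have : \sum_a' N a' = #|K|%:R.
  rewrite exchange_big -(card_rcoset K z) -sum1_card natr_sum.
  apply: eq_bigr => g _; rewrite -[RHS](sum_delta (fun=> 1) (g^-1%g b)).
  by apply: eq_bigr => x _; rewrite mul1r -[in RHS](inj_eq (@perm_inj _ g)) permKV eq_sym.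
under eq_bigr do rewrite Nconst.
by rewrite sumr_const => Nn; apply: (mulIf n_neq0); rewrite divfK // mulr_natr -Nn.
Qed.

Lemma coset_derangement z :
  exists2 g, g \in (K :* z)%g & forall a, g a != a.
Proof.
have [a [b ab]] : exists a b : T, a != b.
  have /card_gt1P[a [b [_ _ ab]]] := trans2_card_gt1.
  by exists a, b.
pose fix_ (g : {perm T}) : algC := \sum_a (g a == a)%:R.
have sum_fix : \sum_(g in (K :* z)%g) (fix_ g - 1) = 0.
  rewrite sumrB exchange_big; under eq_bigr do rewrite coset_point_count.
  rewrite sumr_const -[X in X - _]mulr_natr divfK //.
  by rewrite sumr_const card_rcoset subrr.
(* Products act from left to right, so [k * z] fixes both [a] and [b]. *)
have [k Kk [ka kb]] : exists2 k, k \in K & k a = (z^-1)%g a /\ k b = (z^-1)%g b.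
  by apply: trans2P; rewrite // (inj_eq perm_inj).
have Kkz : (k * z)%g \in (K :* z)%g by rewrite mem_rcoset mulgK.
have fix_kz : 2%:R <= fix_ (k * z)%g.
  rewrite /fix_ (bigD1 a) // (bigD1 b) 1?eq_sym //= !permM ka kb !permKV !eqxx.
  by rewrite addrA -(natrD _ 1 1) lerDl sumr_ge0.
have [/existsP[g /andP[Kg /forallP]]|noder] :=
    boolP [exists g in (K :* z)%g, [forall a, g a != a]]; first by exists g.
(* Without derangements every term of [sum_fix] is nonnegative, hence zero, contradicting
   [fix_kz]. *)
have fix_ge1 g : g \in (K :* z)%g -> 0 <= fix_ g - 1.
  move=> Kg; rewrite subr_ge0; move: noder; rewrite negb_exists_in.
  move=> /forall_inP/(_ g Kg); rewrite negb_forall => /existsP[x].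
  rewrite negbK => gx.
  by rewrite /fix_ (bigD1 x) //= gx lerDl sumr_ge0.
have /eqP := psumr_eq0P fix_ge1 sum_fix Kkz.
rewrite subr_eq0 => /eqP fix1; move: fix_kz.
by rewrite fix1 (ler_nat _ 2 1).
Qed.

(** Conjugation by an element of [K] fixing [p] and taking [r] to [q] permutes [D], so the images of
    [p] are equidistributed over the [n - 1] other points. *)
Lemma derangement_point_count (D : {set {perm T}}) p q :
    (K \subset 'N(D))%g -> {in D, forall u : {perm T}, forall x, u x != x} ->
    p != q ->
  \sum_(u in D) (u p == q)%:R = #|D|%:R / (n%:R - 1) :> algC.
Proof.
move=> nDK derD pq.
pose N r : algC := \sum_(u in D) (u p == r)%:R.
have Nconst r : r != p -> N r = N q.
  rewrite eq_sym => pr; have [t Kt [tp tr]] := trans2P _ _ _ _ pr pq.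
  rewrite [RHS](reindex_inj (conjg_inj t)) /=; apply: eq_big => [u|u _].
    by rewrite memJ_norm // (subsetP nDK).
  by rewrite -[in RHS]tp permJ -tr (inj_eq perm_inj).
have : \sum_r N r = #|D|%:R.
  rewrite exchange_big -sum1_card natr_sum; apply: eq_bigr => u _.
  by rewrite -[RHS](sum_delta (fun=> 1) (u p)); apply: eq_bigr => x _; rewrite mul1r.
rewrite (bigD1 p) //= {1}/N big1 ?add0r => [|u Du]; last first.
  by rewrite (negbTE (derD u Du p)).
under eq_bigr do rewrite Nconst //.
rewrite sumr_const cardC1 -subn1 => Nn.
apply: (mulIf n1_neq0); rewrite divfK //.
by rewrite -[X in _ - X]/(1%:R) -natrB // mulr_natr -Nn.
Qed.

End TwoTransitive.

(** * The matrix of [psi_char] applied to functions of zero sum *)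

Section PsiModule.

Variables (T : finType) (H : {group {perm T}}).

Lemma psi_charE g : g \in H ->
  psi_char H g = \sum_a (g a == a)%:R - 1.
Proof.
move=> Hg; rewrite /psi_char !cfunE cfun1E Hg mulr1n; congr (_ - _).
rewrite -sum1_card natr_sum big_mkcond; apply: eq_bigr => a _.
by rewrite inE; case: eqP.
Qed.

Lemma psi_char1 : psi_char H 1%g = #|T|%:R - 1.
Proof.
rewrite psi_charE //; congr (_ - _); rewrite -sum1_card natr_sum.
by apply: eq_bigr => a _; rewrite perm1 eqxx.
Qed.

(** The zero sum kills the [- 1] in [psi_char], and [h * g^-1] fixes [a] exactly when [h] and [g]
    agree at [a]. *)
Lemma mul_idempotent_mx_psi (F : {perm T} -> algC) k :
    \sum_(h in H) F h = 0 ->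
  (idempotent_mx (psi_char H) *m \col_l F (enum_val l)) k 0 =
  (#|T|%:R - 1) / #|H|%:R *
    \sum_a \sum_(h in H) F h * (h a == enum_val k a)%:R.
Proof.
move=> F0; rewrite mxE; under eq_bigr do rewrite !mxE psi_char1.
rewrite (sum_ord_group _ _ (fun h => (#|T|%:R - 1) / #|H|%:R *
  psi_char H (h * (enum_val k)^-1)%g * F h)).
transitivity ((#|T|%:R - 1) / #|H|%:R *
   (\sum_(h in H) \sum_a F h * (h a == enum_val k a)%:R - \sum_(h in H) F h)).
  rewrite -sumrB mulr_sumr; apply: eq_bigr => h Hh.
  rewrite psi_charE; last by rewrite groupM ?groupV ?enum_valP.
  rewrite -mulrA; congr (_ * _); rewrite mulrC mulrBr mulr1 mulr_sumr.
  congr (_ - _); apply: eq_bigr => a _; rewrite permM; congr (_ * _%:R).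
  by rewrite -(inj_eq (@perm_inj _ (enum_val k))) permKV.
by rewrite F0 subr0 exchange_big.
Qed.

End PsiModule.

Lemma sum_rcoset (gT : finGroupType) (A : {set gT}) (x : gT) (F : gT -> algC) :
  \sum_(g in (A :* x)%g) F g = \sum_(k in A) F (k * x)%g.
Proof.
rewrite (reindex_inj (mulIg x)) /=.
by apply: eq_bigl => k; rewrite mem_rcoset mulgK.
Qed.

(** As [z] normalises [K], conjugation by [K] keeps the coset of [z]; it also preserves having no
    fixed point. *)
Lemma coset_derangements_norm (T : finType) (K : {group {perm T}}) z :
  z \in ('N(K))%g -> (K \subset 'N([set u in K :* z | [forall a, u a != a]]))%g.
Proof.
move=> nKz; apply/subsetP => t Kt; rewrite inE; apply/subsetP => _ /imsetP[u Du ->].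
move: Du; rewrite !inE !mem_rcoset => /andP[Ku /forallP du]; apply/andP; split.
  have -> : (u ^ t * z^-1 = t^-1 * (u * z^-1) * t ^ z^-1)%g.
    by rewrite !conjgE invgK !mulgA mulgKV.
  apply: groupM; last by rewrite memJ_norm ?groupV.
  by rewrite groupM ?groupV.
by apply/forallP => a; rewrite -[a](permKV t) permJ (inj_eq perm_inj).
Qed.

(** * Comparison of the coset matrices *)

Section Rigidity.

Variables (T : finType) (G K : {group {perm T}}).
Hypotheses (nKG : (K <| G)%g) (trK : [transitive^2 K, on [set: T] | 'P]).

Local Notation n := #|T|.
Local Notation c := ((n%:R - 1) / #|K|%:R : algC).

Variable S : {set {perm T}}.
Hypothesis cocliqueS : coclique G S.

Let f g : algC := (g \in S)%:R - n%:R^-1.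
Let M x a b : algC := \sum_(g in (K :* x)%g) f g * (g a == b)%:R.

(** This and [f_psi] are what tightness of the ratio bound in [K] gives on each coset. *)
Hypothesis sum_f : forall x, x \in G -> \sum_(g in (K :* x)%g) f g = 0.
Hypothesis f_psi : forall x g, x \in G -> g \in (K :* x)%g ->
  f g = c * \sum_a M x a (g a).

Let n_neq0 : n%:R != 0 :> algC.
Proof. by rewrite pnatr_eq0 -lt0n ltnW // (trans2_card_gt1 _ _ trK). Qed.
Let n1_neq0 : n%:R - 1 != 0 :> algC.
Proof. by rewrite subr_eq0 gt_eqF // ltr1n (trans2_card_gt1 _ _ trK). Qed.

Lemma row_sum x a : x \in G -> \sum_b M x a b = 0.
Proof.
move=> Gx; rewrite exchange_big /= -[RHS](sum_f x Gx); apply: eq_bigr => g _.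
exact: (sum_delta _ (fun=> f g)).
Qed.

(** With [F = f] and [A] a coset, the right side is the entrywise inner product of [N] with the
    coset matrix. *)
Lemma coset_pairing (N : T -> T -> algC) (F : {perm T} -> algC)
    (A : {set {perm T}}) :
  \sum_(g in A) F g * \sum_a N a (g a) =
  \sum_a \sum_b N a b * \sum_(g in A) F g * (g a == b)%:R.
Proof.
under eq_bigr do rewrite mulr_sumr.
rewrite exchange_big; apply: eq_bigr => a _ /=.
transitivity (\sum_b \sum_(g in A) F g * N a b * (g a == b)%:R).
  rewrite exchange_big; apply: eq_bigr => g _ /=.
  by rewrite (sum_delta _ (fun b => F g * N a b)).
by apply: eq_bigr => b _; rewrite mulr_sumr; apply: eq_bigr => g _; ring.
Qed.

(** All pairs [(a, b)] occur equally often in [K :* y], so only the zero row sums of [M x]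
    remain. *)
Lemma sum_f_psi x y : x \in G -> y \in G ->
  \sum_(h in (K :* y)%g) \sum_a M x a (h a) = 0.
Proof.
move=> Gx Gy; have := coset_pairing (M x) (fun=> 1) (K :* y)%g.
under eq_bigr do rewrite mul1r.
move=> ->; rewrite big1 // => a _.
under eq_bigr do under eq_bigr do rewrite mul1r.
under eq_bigr do rewrite (coset_point_count _ _ trK).
by rewrite -mulr_suml row_sum ?mul0r.
Qed.

(** The neighbours of [h] in [K :* x] are the [h * u] with [u] in [D]. After expanding [f] by
    [f_psi], the [J] part of the sum over [D] meets zero row sums and the [- I] part gives the last
    term. *)
Lemma sum_nonadjacent x y h (D : {set {perm T}}) :
    x \in G -> y \in G -> h \in (K :* y)%g ->
    D = [set u in (K :* (y^-1 * x))%g | [forall a, u a != a]] ->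
  \sum_(g in (K :* x)%g | derangement_adj G h g) (g \in S)%:R =
  #|D|%:R / n%:R - #|D|%:R / #|K|%:R * \sum_a M x a (h a).
Proof.
move=> Gx Gy Kyh defD.
have [sKG nKG'] := andP nKG.
have Gh : h \in G.
  by case/rcosetP: Kyh => k Kk ->; rewrite groupM // (subsetP sKG).
have Dh g : (h * g)%g \in (K :* x)%g = (g \in K :* (y^-1 * x))%g.
  case/rcosetP: Kyh => k Kk ->; rewrite !mem_rcoset -!mulgA (groupMl _ Kk).
  rewrite invMg invgK !mulgA -(memJ_norm _ (subsetP nKG' y Gy)) conjgE.
  by rewrite !mulgA mulVg mul1g.
have cardD a b : h a != b ->
    \sum_(u in D) (u (h a) == b)%:R = #|D|%:R / (n%:R - 1) :> algC.
  apply: (derangement_point_count _ _ trK).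
    by rewrite defD coset_derangements_norm // (subsetP nKG') // groupM ?groupV.
  by move=> u; rewrite defD inE => /andP[_ /forallP].
transitivity (\sum_(u in D) (n%:R^-1 + c * \sum_a M x a (u (h a)))).
  rewrite (reindex_inj (mulgI h)) /=; apply: eq_big => [u|u].
    rewrite Dh defD [in RHS]inE /derangement_adj /=.
    have -> : (h * u * h^-1 = u ^ h^-1)%g by rewrite conjgE invgK mulgA.
    rewrite derangementsJ ?groupV // inE; case: rcosetP => //= -[k Kk ->].
    by rewrite !groupM ?groupV // (subsetP sKG).
  case/andP => Kxu _; have := f_psi x _ Gx Kxu; rewrite /f => /(canRL (subrK _)) ->.
  rewrite addrC; congr (_ + _ * _).
  by apply: eq_bigr => a _; rewrite permM.
rewrite big_split /= sumr_const -mulr_sumr; congr (_ + _).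
  by rewrite mulr_natl.
rewrite exchange_big.
under eq_bigr => a _.
  have -> : \sum_(u in D) M x a (u (h a)) = - (#|D|%:R / (n%:R - 1)) * M x a (h a).
    transitivity (\sum_b M x a b * \sum_(u in D) (u (h a) == b)%:R).
      under [RHS]eq_bigr do rewrite mulr_sumr.
      by rewrite [RHS]exchange_big; apply: eq_bigr => u _;
         rewrite (sum_delta _ (M x a)).
    have := row_sum x a Gx; rewrite (bigD1 (h a)) //= => /(canRL (addKr _)).
    rewrite addr0 => rs.
    rewrite (bigD1 (h a)) //= big1 ?mulr0 ?add0r; last first.
      by move=> u; rewrite defD inE => /andP[_ /forallP/(_ (h a))/negbTE->].
    under eq_bigr => b hb do rewrite cardD 1?eq_sym //.
    by rewrite -mulr_suml rs; ring.
  over.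
rewrite -mulr_sumr; field.
by rewrite n1_neq0 cardG_neq0C.
Qed.

Lemma gram_const x y : x \in G -> y \in G ->
  \sum_a \sum_b M x a b * M y a b = #|K|%:R ^+ 2 / n%:R ^+ 2.
Proof.
move=> Gx Gy.
pose D := [set u in (K :* (y^-1 * x))%g | [forall a, u a != a]].
have D_neq0 : #|D|%:R != 0 :> algC.
  have [u Ku du] := coset_derangement _ _ trK (y^-1 * x)%g.
  rewrite pnatr_eq0 -lt0n card_gt0; apply/set0Pn; exists u.
  by rewrite inE Ku; apply/forallP.
have [_ cS] := cocliqueS.
(* This counts the edges of [S] between the two cosets from the endpoint [h]. *)
have : \sum_(h in (K :* y)%g) (h \in S)%:R *
    \sum_(g in (K :* x)%g | derangement_adj G h g) (g \in S)%:R = 0 :> algC.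
  rewrite big1 // => h _; rewrite mulr_sumr big1 // => g /andP[_ adj].
  rewrite -natrM mulnb; case: andP => // -[Sh Sg].
  by have := cS _ _ Sh Sg; rewrite adj.
under eq_bigr => h Kh do rewrite (sum_nonadjacent x y h D) // mulrBr.
rewrite sumrB -mulr_suml => /eqP; rewrite subr_eq0 => /eqP.
have sumS : \sum_(h in (K :* y)%g) (h \in S)%:R = #|K|%:R / n%:R :> algC.
  have := sum_f y Gy; rewrite /f sumrB => /eqP; rewrite subr_eq0 => /eqP ->.
  by rewrite sumr_const card_rcoset mulr_natl.
rewrite sumS.
have -> : \sum_(h in (K :* y)%g) (h \in S)%:R *
      (#|D|%:R / #|K|%:R * \sum_a M x a (h a)) =
    #|D|%:R / #|K|%:R * \sum_a \sum_b M x a b * M y a b.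
  rewrite -coset_pairing mulr_sumr.
  (* The indicator of [S] is [f + 1/n]; [sum_f_psi] kills the constant part. *)
  transitivity (\sum_(h in (K :* y)%g) #|D|%:R / #|K|%:R * (f h * \sum_a M x a (h a)) +
     #|D|%:R / #|K|%:R / n%:R * \sum_(h in (K :* y)%g) \sum_a M x a (h a)).
    by rewrite mulr_sumr -big_split; apply: eq_bigr => h _ /=; rewrite /f; ring.
  by rewrite sum_f_psi // mulr0 addr0.
move=> eqDK; have KD : #|D|%:R / #|K|%:R != 0 :> algC.
  by rewrite mulf_neq0 ?invr_eq0 ?cardG_neq0C.
apply: (mulfI KD); rewrite -eqDK; field.
by rewrite n_neq0 cardG_neq0C.
Qed.

Lemma coset_matrix_const x a b : x \in G -> M x a b = M 1%g a b.
Proof.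
move=> Gx.
have MR y p q : M y p q \is Num.real.
  by apply: rpred_sum => g _; rewrite rpredM ?rpredB ?rpredV ?realn.
have sq_ge0 p q : 0 <= (M x p q - M 1%g p q) ^+ 2.
  by rewrite -realEsqr rpredB.
have : \sum_p \sum_q (M x p q - M 1%g p q) ^+ 2 = 0.
  transitivity (\sum_p \sum_q M x p q * M x p q +
    \sum_p \sum_q M 1%g p q * M 1%g p q - 2%:R * \sum_p \sum_q M x p q * M 1%g p q).
    rewrite -big_split mulr_sumr -sumrB; apply: eq_bigr => p _ /=.
    rewrite -big_split mulr_sumr -sumrB; apply: eq_bigr => q _ /=.
    by ring.
  by rewrite !gram_const //; ring.
move/(psumr_eq0P (fun p _ => sumr_ge0 _ (fun q _ => sq_ge0 p q)))/(_ a isT).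
move/(psumr_eq0P (fun q _ => sq_ge0 a q))/(_ b isT)/eqP.
by rewrite sqrf_eq0 subr_eq0 => /eqP.
Qed.

Lemma psi_module_of_cosets :
  in_char_module (psi_char G) (char_vec G S - n%:R^-1 *: const_mx 1).
Proof.
(* As [x] runs over [G] each coset occurs [#|K|] times, so no transversal is chosen. *)
have sum_cosets (F : {perm T} -> algC) :
    \sum_(x in G) \sum_(g in (K :* x)%g) F g = #|K|%:R * \sum_(g in G) F g.
  under eq_bigr do rewrite sum_rcoset.
  rewrite exchange_big mulr_natl -sumr_const; apply: eq_bigr => k Kk /=.
  rewrite [RHS](reindex_inj (mulgI k)) /=; apply: eq_bigl => x.
  by rewrite groupMl // (subsetP (normal_sub nKG)).
have fG : \sum_(g in G) f g = 0.
  by apply: (mulfI (cardG_neq0C _ K)); rewrite mulr0 -sum_cosets big1.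
(* The vector is its own preimage: the idempotent is shown to fix it. *)
exists (\col_l f (enum_val l)); apply/colP => k.
rewrite mul_idempotent_mx_psi //; set g := enum_val k.
transitivity (f g); first by rewrite !mxE mulr1.
have Gg : g \in G by apply: enum_valP.
have Kg : g \in (K :* g)%g by rewrite rcoset_refl.
rewrite (f_psi g g Gg Kg) !mulr_sumr; apply: eq_bigr => a _.
rewrite coset_matrix_const //.
(* The left side is [#|G|] copies of [M 1], which converts the factor [(n - 1) / #|K|] of [f_psi]
   into [(n - 1) / #|G|]. *)
have : \sum_(x in G) M x a (g a) = #|K|%:R * \sum_(h in G) f h * (h a == g a)%:R.
  exact: sum_cosets.
under eq_bigr do rewrite coset_matrix_const //.
rewrite sumr_const => eqM.
apply: (mulfI (cardG_neq0C _ G)); rewrite mulrCA [X in _ * X]mulr_natl eqM; field.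
by rewrite !cardG_neq0C.
Qed.

End Rigidity.

(** * Tightness in every coset, and the conclusion *)

Theorem theorem4p3 (T : finType) (n : nat) (G K : {group {perm T}})
    (cardT : #|T| = n)
    (trG : [transitive^2 G, on [set: T] | 'P])
    (minK : [min K | K <| G & ~~ abelian K]%g)
    (trK : [transitive^2 K, on [set: T] | 'P])
    (leastK : least_eigenvalue (derangement_adj_mx K)
                (- (#|derangements K|%:R / (n%:R - 1))))
    (uniqK : unique_irr_affording (psi_char K)
               (- (#|derangements K|%:R / (n%:R - 1))))
    (S : {set {perm T}}) (maxS : maximum_coclique G S) :
  in_char_module (psi_char G) (char_vec G S - n%:R^-1 *: const_mx 1).
Proof.
have nKG : (K <| G)%g by have /mingroupp/andP[] := minK.
have [coclS max_S] := maxS; have [sSG cS] := coclS.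
have n_gt1 := trans2_card_gt1 _ _ trK.
have /card_gt0P[a _] := ltnW n_gt1.
(* The stabiliser of [a] is a coclique of index at most [n], and [S] is at least as large. *)
have big_S : (#|G| <= n * #|S|)%N.
  rewrite -(card_orbit_stab 'P G a) leq_mul // -?cardT ?max_card //.
  apply: max_S; split; first exact: subsetIl.
  move=> g h /setIP[_ /astab1P ga] /setIP[_ /astab1P ha].
  rewrite /derangement_adj /= inE negb_and negb_forall; apply/orP; right.
  apply/existsP; exists a; rewrite negbK permM.
  by move: ga ha; rewrite /= !apermE => ga ->; rewrite -{1}ga permK.
(* Right translation by [x] cancels in [h * g^-1], so these translated pieces are cocliques of
   [K]. *)
pose Sx x := [set k in K | (k * x)%g \in S].
have coclSx x : x \in G -> coclique K (Sx x).
  move=> Gx; split; first by apply/subsetP => k; rewrite inE => /andP[].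
  move=> k l; rewrite !inE => /andP[Kk Sk] /andP[Kl Sl].
  have := cS _ _ Sk Sl; rewrite /derangement_adj /= invMg mulgA mulgK !inE.
  have Klk : (l * k^-1)%g \in K by rewrite groupM ?groupV.
  by rewrite Klk (subsetP (normal_sub nKG)).
have der_gt0 : (0 < #|derangements K|)%N.
  have [d Kd dd] := coset_derangement _ _ trK 1%g; rewrite mulg1 in Kd.
  by apply/card_gt0P; exists d; rewrite inE Kd; apply/forallP.
rewrite -{}cardT in leastK uniqK big_S *.
have bound x : x \in G -> (#|T| * #|Sx x| <= #|K|)%N.
  by move=> Gx; apply: ratio_bound (coclSx x Gx) der_gt0 leastK.
have sum_Sx : (\sum_(x in G) #|Sx x| = #|K| * #|S|)%N.
  transitivity (\sum_(x in G) \sum_(k in K) ((k * x)%g \in S : nat))%N.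
    apply: eq_bigr => x _; rewrite -sum1_card [RHS]big_mkcond [LHS]big_mkcond.
    by apply: eq_bigr => k _; rewrite inE; case: (k \in K) => //; case: (_ \in S).
  rewrite exchange_big -sum_nat_const; apply: eq_bigr => k Kk /=.
  rewrite -sum1_card [RHS]big_mkcond [LHS]big_mkcond [RHS](reindex_inj (mulgI k)) /=.
  apply: eq_bigr => x _; case: (boolP (_ \in S)) => [Skx|_]; last by case: ifP.
  suff -> : x \in G by [].
  by rewrite -(groupMl x (subsetP (normal_sub nKG) k Kk)) (subsetP sSG).
have tight x : x \in G -> (#|T| * #|Sx x| = #|K|)%N.
  move=> Gx; apply/eqP.
  (* Summed over [G], the bounds give [n * #|S| <= #|G|] up to the factor [#|K|]; [big_S] forces
     equality in the sum, hence in each term. *)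
  have := leqif_sum (fun x (Gx : x \in G) => leqif_eq (bound x Gx)).
  rewrite sum_nat_const -big_distrr /= sum_Sx => sum_le.
  have : (#|T| * (#|K| * #|S|) == #|G| * #|K|)%N.
    by rewrite eqn_leq sum_le mulnCA (mulnC #|G|) leq_mul2l big_S orbT.
  by rewrite (eq_leqif sum_le) => /forall_inP; apply.
have T_neq0 : #|T|%:R != 0 :> algC by rewrite pnatr_eq0 -lt0n ltnW.
have fx0 x : x \in G ->
    \sum_(k in K) (((k * x)%g \in S)%:R - #|T|%:R^-1) = 0 :> algC.
  move=> Gx; rewrite sumrB sumr_const -(tight x Gx).
  rewrite -[_^-1 *+ _]mulr_natl natrM mulrAC mulfV //.
  rewrite mul1r; apply/eqP; rewrite subr_eq0 -sum1_card natr_sum; apply/eqP.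
  rewrite [RHS]big_mkcond [LHS]big_mkcond.
  by apply: eq_bigr => k _; rewrite inE; case: (k \in K) => //; case: (_ \in S).
apply: (psi_module_of_cosets _ _ _ nKG trK) => // [x Gx|x g Gx].
  by rewrite sum_rcoset fx0.
case/rcosetP => k Kk ->.
pose w : 'cV[algC]_#|K| := \col_l (((enum_val l * x)%g \in S)%:R - #|T|%:R^-1).
(* By the equality case [w] is an image under an idempotent, hence fixed by it. *)
have defw : idempotent_mx (psi_char K) *m w = w.
  have := ratio_bound_eq _ _ _ _ n_gt1 (coclSx x Gx) der_gt0 leastK _ uniqK (tight x Gx).
  have -> : char_vec K (Sx x) - #|T|%:R^-1 *: const_mx 1 = w.
    by apply/colP => l; rewrite !mxE mulr1 inE enum_valP.
  have [/irrP[j ->] _ _] := uniqK => <-.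
  by rewrite mulmxA mul_idempotent_mx eqxx scale1r.
(* The entry of [defw] at [k] is the required formula, once [x] is cancelled from
   [(h * x) p = (k * x) p]. *)
have := mul_idempotent_mx_psi _ _ (fun k => ((k * x)%g \in S)%:R - #|T|%:R^-1)
  (enum_rank_in Kk k) (fx0 x Gx).
rewrite -/w defw mxE !enum_rankK_in // => ->; congr (_ * _).
apply: eq_bigr => p _; rewrite sum_rcoset; apply: eq_bigr => h _.
by rewrite !permM (inj_eq perm_inj).
Qed.
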